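(* Fix $\epsilon,C>0$ and integers $j\ge1$, $k>\ell\ge2$. There exist $n_0>0$ and constants $\beta\ge\alpha>0$, all depending only on $\epsilon,C,j,k,\ell$, such that for all integers $n\ge n_0$ and all $p>0$, any $n$-vertex graph $G$ satisfying $$\mathrm{Hom}(P_1,G)\ge\epsilon pn^2\qquad\text{and}\qquad\mathrm{Hom}(C_{2\ell},G)\le Cp^{2\ell}n^{2\ell}$$ also satisfies $$\alpha p^jn^{j+1}\le\mathrm{Inj}(P_j,G)\le\beta p^jn^{j+1}\qquad\text{and}\qquad\alpha p^{2k}n^{2k}\le\mathrm{Inj}(C_{2k},G)\le\beta p^{2k}n^{2k}.$$
   Context: Graphs are finite, unweighted, undirected and simple. $C_m$ is the cycle of length $m$ and $P_j$ is the path of length $j$ (with $j+1$ vertices and $j$ edges). $\mathrm{Hom}(H,G)$ is the number of graph homomorphisms from $H$ to $G$, and $\mathrm{Inj}(H,G)$ is the number of injective ones. *)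

(* Defs.v *)
From mathcomp Require Import all_boot all_order all_algebra.
From mathcomp Require Import reals.

Set Implicit Arguments.
Unset Strict Implicit.
Unset Printing Implicit Defensive.

Record sgraph := SGraph {
  vertex :> finType;
  adj : rel vertex;
  adj_sym : symmetric adj;
  adj_irrefl : irreflexive adj }.

Definition path_adj (j : nat) : rel 'I_j.+1 :=
  fun x y => (y == x.+1 :> nat) || (x == y.+1 :> nat).

Lemma path_adj_sym j : symmetric (@path_adj j).
Proof. by move=> x y; rewrite /path_adj orbC. Qed.

Lemma path_adj_irrefl j : irreflexive (@path_adj j).
Proof. by move=> x; rewrite /path_adj orbb ltn_eqF. Qed.

(* The length of a path is its number of edges, so P_j has j.+1 vertices. *)
Definition path_graph (j : nat) : sgraph :=
  SGraph (@path_adj_sym j) (@path_adj_irrefl j).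

(* [ordS] is the successor modulo m. The conjunct x != y only matters for
   m = 1, where it removes the loop; for 3 <= m this is the usual cycle. *)
Definition cycle_adj (m : nat) : rel 'I_m :=
  fun x y => (x != y) && ((y == ordS x) || (x == ordS y)).

Lemma cycle_adj_sym m : symmetric (@cycle_adj m).
Proof. by move=> x y; rewrite /cycle_adj eq_sym orbC. Qed.

Lemma cycle_adj_irrefl m : irreflexive (@cycle_adj m).
Proof. by move=> x; rewrite /cycle_adj eqxx. Qed.

Definition cycle_graph (m : nat) : sgraph :=
  SGraph (@cycle_adj_sym m) (@cycle_adj_irrefl m).

Definition is_hom (H G : sgraph) (f : {ffun H -> G}) : bool :=
  [forall x : H, forall y : H, adj x y ==> adj (f x) (f y)].

Definition nb_hom (H G : sgraph) : nat :=
  #|[set f : {ffun H -> G} | is_hom f]|.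

Definition nb_inj (H G : sgraph) : nat :=
  #|[set f : {ffun H -> G} | is_hom f & injectiveb f]|.

(* Main.v *)
Require Import Defs.
From mathcomp Require Import all_boot all_order all_algebra.
From mathcomp Require Import reals.
From mathcomp Require Import ring lra zify.

Set Implicit Arguments.
Unset Strict Implicit.
Unset Printing Implicit Defensive.

Import Order.TTheory GRing.Theory Num.Theory.
Local Open Scope ring_scope.

(* Write x = p n. Both the numbers t_s of closed walks of length 2s and the numbers of
   walks of length 2s are log-convex in s by Cauchy-Schwarz, and t is submultiplicative;
   this replaces the spectral theorem. From t_l <= C x^(2l) it follows that t_s = O(x^(2s))
   for all s >= l, and then that the number of walks of length s is O(n x^s) for all s.

   For the lower bounds, deleting the edges at vertices of degree >> x (few edges, since
   the sum of the squared degrees is O(n x^2)) and then pruning vertices of low degree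
   leaves a subgraph with Omega(n x) edges whose nonzero degrees are all of order x.
   Paths in it are extended greedily. Its number of closed walks of length 2k is
   Omega(x^(2k)); those that repeat a vertex number at most O(1) times
   sum_v W_a(v,v) W_b(v,v) with a + b = 2k, which log-convexity bounds by
   sum_v W_2(v,v) W_(2k-2)(v,v) = O(x t_(k-1)) = O(x^(2k-1)), where k - 1 >= l is used.
   This is a small fraction because t_l >= n (eps x)^l forces x -> oo as n -> oo. *)

(** * Cauchy-Schwarz and log-convex sequences *)

Lemma cauchy_schwarz_sum (R : realFieldType) (I : finType) (f g : I -> R) :
  (\sum_i f i * g i) ^+ 2 <= (\sum_i f i ^+ 2) * (\sum_i g i ^+ 2).
Proof.
have key : 0 <= \sum_i \sum_j (f i * g j - f j * g i) ^+ 2.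
  by apply: sumr_ge0 => i _; apply: sumr_ge0 => j _; apply: sqr_ge0.
(* Lagrange's identity: the double sum of squares is twice the Cauchy-Schwarz defect. *)
have E : \sum_i \sum_j (f i * g j - f j * g i) ^+ 2 =
    (\sum_i f i ^+ 2) * (\sum_i g i ^+ 2) *+ 2 - (\sum_i f i * g i) ^+ 2 *+ 2.
  set F := \sum_i f i ^+ 2; set G := \sum_i g i ^+ 2; set P := \sum_i f i * g i.
  have FG : F * G = \sum_i \sum_j f i ^+ 2 * g j ^+ 2 by rewrite big_distrlr.
  have GF : F * G = \sum_i \sum_j f j ^+ 2 * g i ^+ 2 by rewrite FG exchange_big.
  have PP : P ^+ 2 = \sum_i \sum_j (f i * g i) * (f j * g j) by rewrite expr2 big_distrlr.
  rewrite !mulr2n {1}FG GF PP -!big_split -sumrB /=.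
  apply: eq_bigr => i _; rewrite -!big_split -sumrB /=.
  by apply: eq_bigr => j _; ring.
by rewrite E in key; lra.
Qed.

Definition log_convex (R : realFieldType) (a : nat -> R) :=
  (forall i, 0 <= a i) /\ (forall i, a i.+1 ^+ 2 <= a i * a i.+2).

(** The ratios [a i.+1 / a i] are nondecreasing. The cross-multiplied form makes sense when terms
    vanish: a zero term forces the next one to be zero. *)
Lemma log_convex_ratio (R : realFieldType) (a : nat -> R) (i j : nat) :
  log_convex a -> (i <= j)%N -> a i.+1 * a j <= a i * a j.+1.
Proof.
move=> [a0 ac] /subnK <-; elim: (j - i)%N => [|m IH]; first by rewrite mulrC.
rewrite addSn; set s := (m + i)%N in IH *.
have := a0 s; rewrite le_eqVlt => /orP[/eqP s0|s0].
  have : a s.+1 ^+ 2 <= 0 by rewrite (le_trans (ac s)) // -s0 mul0r.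
  by rewrite real_exprn_even_le0 ?num_real //= => /eqP ->; rewrite mulr0 mulr_ge0.
rewrite -(ler_pM2r s0) -mulrA [a s.+1 * _]mulrC mulrA.
apply: (le_trans (ler_wpM2r (a0 _) IH)).
by rewrite -mulrA -expr2 -mulrA [a s.+2 * _]mulrC ler_wpM2l.
Qed.

(** Among pairs of indices with a given sum, moving the two indices apart increases the product;
    each unit shift is one use of [log_convex_ratio]. *)
Lemma log_convex_spread (R : realFieldType) (a : nat -> R) (m i j : nat) :
  log_convex a -> (i <= j)%N -> a (i + m)%N * a j <= a i * a (j + m)%N.
Proof.
move=> ac; elim: m i => [|m IH] i ij; first by rewrite !addn0.
move: ij; rewrite leq_eqVlt => /orP[/eqP <-|ij]; first by rewrite mulrC.
rewrite addnS -addSn (le_trans (IH _ ij)) // addnS.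
by rewrite log_convex_ratio // ltnW // ltn_addr.
Qed.

(** The outer pair is anchored at index 1 and not 0, because for closed walks at a vertex the term
    [a 1] is the degree. *)
Lemma log_convex_prod (R : realFieldType) (a : nat -> R) (s t : nat) :
  log_convex a -> (0 < s)%N -> (0 < t)%N -> a s * a t <= a 1%N * a (s + t).-1.
Proof.
case: s t => [//|s] [//|t] ac _ _.
by have := @log_convex_spread _ a s 1 t.+1 ac isT; rewrite add1n (addnC t.+1).
Qed.

(* If the bound fails at s > l, it fails at the first such s, where a s > Q * a s.-1;
   by log-convexity this ratio persists, so the bound fails ever after. *)
Lemma log_convex_le_expr (R : realFieldType) (a : nat -> R) (Q : R) (l s : nat) :
  log_convex a -> 0 < Q -> a l <= Q ^+ l ->
  (forall N, exists2 M, (N <= M)%N & a M <= Q ^+ M) ->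
  (l <= s)%N -> a s <= Q ^+ s.
Proof.
move=> [a0 ac] Q0 al unb /subnK <-.
elim: (s - l)%N => [|m IH]; first by rewrite add0n.
rewrite addSn; set u := (m + l)%N in IH *.
rewrite leNgt; apply/negP => bad.
suff H t : Q ^+ (u.+1 + t) < a (u.+1 + t)%N /\ Q * a (u + t)%N < a (u + t).+1.
  have [M uM] := unb u.+1; rewrite -(subnKC uM) leNgt.
  by have [-> _] := H (M - u.+1)%N.
elim: t => [|t [IH1 IH2]].
  rewrite !addn0; split=> //; apply: le_lt_trans bad.
  by rewrite exprS ler_wpM2l // ltW.
have ap : 0 < a (u + t).+1.
  by apply: lt_trans IH1; rewrite exprn_gt0.
have step : Q * a (u + t).+1 < a (u + t).+2.
  have ac' := ac (u + t)%N.
  rewrite -(ltr_pM2r ap) -mulrA -expr2.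
  apply: (le_lt_trans (ler_wpM2l (ltW Q0) ac')).
  rewrite mulrA [ltRHS]mulrC ltr_pM2r //.
  rewrite lt_neqAle a0 andbT eq_sym; apply/eqP => E.
  move: ac'; rewrite E mulr0 leNgt => /negP; apply.
  by rewrite exprn_gt0.
rewrite !addnS addSn; split=> //.
by apply: lt_trans step; rewrite exprS ltr_pM2l // -addSn.
Qed.

(** Ratios only grow, so the first one bounds all of them from below. This will bound the number of
    closed walks from below, with [d] of the order of the average degree. *)
Lemma log_convex_expr_le (R : realFieldType) (a : nat -> R) (d : R) (m : nat) :
  log_convex a -> 0 < d -> d * a 0%N <= a 1%N -> 0 < a 0%N ->
  d ^+ m * a 0%N <= a m.
Proof.
move=> ac d0 a01 a0; elim: m => [|m IH]; first by rewrite mul1r.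
rewrite -(ler_pM2l a0); apply: le_trans (log_convex_ratio ac (leq0n m)).
rewrite exprS -mulrA mulrCA.
apply: (@le_trans _ _ (d * (a 0%N * a m))); first by rewrite ler_pM2l // ler_pM2l.
by rewrite mulrA ler_wpM2r // ac.1.
Qed.

(** * Walk counts, their convexity and their upper bounds *)

Section Walks.
Variables (R : realFieldType) (V : finType).
Implicit Types (e : rel V) (x y z v : V).

(** This is an entry of the m-th power of the adjacency matrix. Since [e] is any relation on the
    fixed type [V], passing to a subgraph is passing to a subrelation. *)
Fixpoint walk e m x y : R :=
  if m is m'.+1 then \sum_z (e x z)%:R * walk e m' z y else (x == y)%:R.

Definition closed_walks e m : R := \sum_x walk e m x x.
Definition open_walks e m : R := \sum_x \sum_y walk e m x y.
Definition degree e x : R := \sum_y (e x y)%:R.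

Lemma walk_ge0 e m x y : 0 <= walk e m x y.
Proof.
elim: m x => [|m IH] x /=; first by rewrite ler0n.
by apply: sumr_ge0 => z _; rewrite mulr_ge0.
Qed.

Lemma closed_walks_ge0 e m : 0 <= closed_walks e m.
Proof. by apply: sumr_ge0 => x _; apply: walk_ge0. Qed.

Lemma open_walks_ge0 e m : 0 <= open_walks e m.
Proof. by apply: sumr_ge0 => x _; apply: sumr_ge0 => y _; apply: walk_ge0. Qed.

Lemma degree_ge0 e x : 0 <= degree e x.
Proof. by apply: sumr_ge0 => y _; rewrite ler0n. Qed.

Lemma sum_diracl x (F : V -> R) : \sum_z (x == z)%:R * F z = F x.
Proof.
rewrite (bigD1 x) //= eqxx mul1r big1 ?addr0 // => z zx.
by rewrite eq_sym (negPf zx) mul0r.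
Qed.

Lemma sum_diracr y (F : V -> R) : \sum_z F z * (z == y)%:R = F y.
Proof. by rewrite -[RHS](sum_diracl y); apply: eq_bigr => z _; rewrite mulrC eq_sym. Qed.

Lemma walk1 e x y : walk e 1 x y = (e x y)%:R.
Proof. exact: sum_diracr. Qed.

Lemma walkD e a b x y : walk e (a + b) x y = \sum_z walk e a x z * walk e b z y.
Proof.
elim: a x => [|a IH] x; first by rewrite add0n /= sum_diracl.
rewrite addSn /=; under eq_bigr do rewrite IH mulr_sumr.
rewrite exchange_big /=; apply: eq_bigr => z _; rewrite mulr_suml.
by apply: eq_bigr => w _; rewrite mulrA.
Qed.

Lemma walk_sym e m x y : symmetric e -> walk e m x y = walk e m y x.
Proof.
move=> es; elim: m x y => [|m IH] x y; first by rewrite /= eq_sym.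
rewrite -[in RHS]addn1 walkD /=; apply: eq_bigr => z _.
by rewrite sum_diracr es mulrC IH.
Qed.

Lemma walk_subrel e e' m x y : subrel e' e -> walk e' m x y <= walk e m x y.
Proof.
move=> sub; elim: m x => [|m IH] x //=; apply: ler_sum => z _.
apply: ler_pM; rewrite ?walk_ge0 // ler_nat.
by case: (boolP (e' x z)) => // /sub ->.
Qed.

Lemma closed_walks_subrel e e' m :
  subrel e' e -> closed_walks e' m <= closed_walks e m.
Proof. by move=> sub; apply: ler_sum => x _; apply: walk_subrel. Qed.

Lemma closed_walks0 e : closed_walks e 0 = #|V|%:R.
Proof.
rewrite /closed_walks /=; under eq_bigr do rewrite eqxx.
by rewrite sumr_const.
Qed.

Lemma open_walks0 e : open_walks e 0 = #|V|%:R.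
Proof.
rewrite -[RHS](closed_walks0 e); apply: eq_bigr => x _ /=.
by rewrite eqxx -[RHS](sum_diracl x (fun=> 1)); under [RHS]eq_bigr do rewrite mulr1.
Qed.

Lemma open_walks1 e : open_walks e 1 = \sum_x degree e x.
Proof. by apply: eq_bigr => x _; apply: eq_bigr => y _; rewrite walk1. Qed.

Lemma walk2_degree e x : symmetric e -> walk e 2 x x = degree e x.
Proof.
move=> es; rewrite (walkD e 1 1); apply: eq_bigr => z _.
by rewrite !walk1 (es z) -natrM mulnb andbb.
Qed.

(** Cauchy-Schwarz over the vertex reached after [a] steps. *)
Lemma walk_prod_le e a b x y : symmetric e ->
  walk e (a + b) x y ^+ 2 <= walk e (2 * a) x x * walk e (2 * b) y y.
Proof.
move=> es; rewrite !mul2n -!addnn !walkD.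
apply: (le_trans (cauchy_schwarz_sum _ _)).
rewrite le_eqVlt; apply/orP; left; apply/eqP; congr (_ * _); apply: eq_bigr => z _.
  by rewrite expr2 [in X in _ * X]walk_sym.
by rewrite expr2 [in X in X * _]walk_sym.
Qed.

Lemma walk_log_convex e x : symmetric e -> log_convex (fun s => walk e (2 * s) x x).
Proof.
move=> es; split=> s; first exact: walk_ge0.
have := @walk_prod_le e s s.+2 x x es; congr (walk _ _ _ _ ^+ 2 <= _); lia.
Qed.

(** The left side is the sum over x, y of the squares of the entries of the (a + b)-th power;
    [walk_prod_le] bounds each square, and the bound factors into a product of two traces. *)
Lemma closed_walksM_le e a b : symmetric e ->
  closed_walks e (2 * (a + b)) <= closed_walks e (2 * a) * closed_walks e (2 * b).
Proof.
move=> es; rewrite /closed_walks big_distrlr /=; apply: ler_sum => x _.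
rewrite mul2n -addnn walkD; apply: ler_sum => y _.
by rewrite [in X in _ * X]walk_sym // -expr2 walk_prod_le.
Qed.

Lemma closed_walksE e a b : symmetric e ->
  closed_walks e (a + b) = \sum_(p : V * V) walk e a p.1 p.2 * walk e b p.1 p.2.
Proof.
move=> es; rewrite -(pair_big predT predT (fun x y => walk e a x y * walk e b x y)) /=.
by apply: eq_bigr => x _; rewrite walkD; apply: eq_bigr => y _; rewrite [in X in _ * X]walk_sym.
Qed.

Lemma closed_walks_log_convex e :
  symmetric e -> log_convex (fun s => closed_walks e (2 * s)).
Proof.
move=> es; split=> s; first exact: closed_walks_ge0.
have -> : (2 * s.+1 = s + s.+2)%N by lia.
rewrite !mul2n -!addnn !closed_walksE //.
by apply: (le_trans (cauchy_schwarz_sum _ _)); under eq_bigr do rewrite expr2;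
  under [X in _ * X]eq_bigr do rewrite expr2.
Qed.

Lemma open_walksD e a b : symmetric e ->
  open_walks e (a + b) = \sum_z (\sum_x walk e a z x) * (\sum_y walk e b z y).
Proof.
move=> es; rewrite /open_walks.
under eq_bigr do under eq_bigr do rewrite walkD.
under eq_bigr do rewrite exchange_big.
rewrite exchange_big /=; apply: eq_bigr => z _.
rewrite big_distrlr; apply: eq_bigr => x _; apply: eq_bigr => y _.
by rewrite (walk_sym a).
Qed.

Lemma open_walks_le_sqr e a b : symmetric e ->
  open_walks e (a + b) ^+ 2 <= open_walks e (2 * a) * open_walks e (2 * b).
Proof.
move=> es; rewrite !mul2n -!addnn !open_walksD //.
by apply: (le_trans (cauchy_schwarz_sum _ _)); under eq_bigr do rewrite expr2;
  under [X in _ * X]eq_bigr do rewrite expr2.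
Qed.

Lemma open_walks_log_convex e :
  symmetric e -> log_convex (fun s => open_walks e (2 * s)).
Proof.
move=> es; split=> s; first exact: open_walks_ge0.
by have := @open_walks_le_sqr e s s.+2 es; congr (open_walks _ _ ^+ 2 <= _); lia.
Qed.

(** Cauchy-Schwarz on pairs of vertices against the constant 1. The bound is crude, but
    log-convexity needs only a growth rate along arbitrarily large indices. *)
Lemma open_walks_closed e j : symmetric e ->
  open_walks e j ^+ 2 <= #|V|%:R ^+ 2 * closed_walks e (2 * j).
Proof.
move=> es; rewrite mul2n -addnn closed_walksE //.
have -> : open_walks e j = \sum_(p : V * V) 1 * walk e j p.1 p.2.
  rewrite /open_walks pair_big /=; apply: eq_bigr => p _; by rewrite mul1r.
apply: (le_trans (cauchy_schwarz_sum _ _)).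
under eq_bigr do rewrite expr1n.
rewrite sumr_const card_prod natrM expr2.
by under [X in _ * X <= _]eq_bigr do rewrite expr2.
Qed.

Lemma open_walks2 e : symmetric e -> open_walks e 2 = \sum_x degree e x ^+ 2.
Proof.
move=> es; rewrite (@open_walksD e 1 1 es); apply: eq_bigr => x _; rewrite expr2.
by congr (_ * _); apply: eq_bigr => y _; rewrite walk1.
Qed.

Lemma closed_walks2 e : symmetric e -> closed_walks e 2 = \sum_x degree e x.
Proof. by move=> es; apply: eq_bigr => x _; apply: walk2_degree. Qed.

Lemma closed_walks_le_expr e (Q : R) l s : symmetric e -> 0 < Q -> (0 < l)%N ->
  closed_walks e (2 * l) <= Q ^+ l -> (l <= s)%N -> closed_walks e (2 * s) <= Q ^+ s.
Proof.
move=> es Q0 l0 tl ls.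
apply: (log_convex_le_expr (l := l) (closed_walks_log_convex es)) => // N.
(* Submultiplicativity propagates the bound from l to all its positive multiples, which are
   unbounded. *)
exists (N.+1 * l)%N; first by nia.
elim: N => [|N IH]; first by rewrite mul1n.
rewrite mulSn exprD (le_trans (closed_walksM_le _ _ es)) //.
by apply: ler_pM => //; apply: closed_walks_ge0.
Qed.

Lemma open_walks_even_le e (Q : R) l s : symmetric e -> 0 < Q -> (0 < l)%N ->
  (0 < #|V|)%N ->
  closed_walks e (2 * l) <= Q ^+ l -> open_walks e (2 * s) <= #|V|%:R * Q ^+ s.
Proof.
move=> es Q0 l0 V0 tl.
have n0 : 0 < #|V|%:R :> R by rewrite ltr0n.
rewrite mulrC -ler_pdivrMr //.
(* Dividing by the number of vertices makes the sequence start at 1, so the bound holds with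
   equality at index 0; [open_walks_closed] supplies it at large indices. *)
apply: (log_convex_le_expr (a := fun s => open_walks e (2 * s) / #|V|%:R) (l := 0)) => //.
- split=> i; first by rewrite divr_ge0 ?open_walks_ge0 // ltW.
  rewrite expr_div_n mulf_div -expr2 ler_pM2r ?invr_gt0 ?exprn_gt0 //.
  by case: (open_walks_log_convex es).
- by rewrite muln0 open_walks0 divff // gt_eqF.
move=> N; exists (N + l)%N; first exact: leq_addr.
rewrite ler_pdivrMr // -(@ler_pXn2r _ 2) ?nnegrE ?open_walks_ge0
  ?mulr_ge0 ?exprn_ge0 //; try exact: ltW.
apply: (le_trans (open_walks_closed _ es)).
rewrite exprMn mulrC ler_pM2r ?exprn_gt0 // -exprM (mulnC _ 2).
by apply: (closed_walks_le_expr es Q0 l0 tl); lia.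
Qed.

(** The squared form covers odd j without a square root of [Q]; it comes from Cauchy-Schwarz between
    lengths 0 and 2j. *)
Lemma open_walks_le e (Q : R) l j : symmetric e -> 0 < Q -> (0 < l)%N ->
  (0 < #|V|)%N ->
  closed_walks e (2 * l) <= Q ^+ l -> open_walks e j ^+ 2 <= #|V|%:R ^+ 2 * Q ^+ j.
Proof.
move=> es Q0 l0 V0 tl.
have := @open_walks_le_sqr e 0 j es; rewrite add0n muln0 open_walks0 => /le_trans; apply.
by rewrite expr2 -mulrA ler_wpM2l // (open_walks_even_le (l := l)).
Qed.

(** For even a and b this is [log_convex_prod]. For odd ones, each factor squared is at most the
    product of the two neighbouring even terms; the four even terms are regrouped into two pairs of
    total length a + b, and [log_convex_prod] applies to each pair. *)
Lemma walk_split_le e a b x : symmetric e -> irreflexive e -> (0 < a)%N -> (0 < b)%N ->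
  ~~ odd (a + b) ->
  walk e a x x * walk e b x x <= degree e x * walk e (a + b - 2) x x.
Proof.
move=> es ei a0 b0; rewrite oddD.
have lc := walk_log_convex x es.
case: (boolP (odd a)) (boolP (odd b)) => oa [] ob //= _.
- have [a' Ea] : exists a', a = (2 * a').+1 by exists a./2; lia.
  have [b' Eb] : exists b', b = (2 * b').+1 by exists b./2; lia.
  have w1 : walk e 1 x x = 0 by rewrite walk1 ei.
  have RHS0 : 0 <= degree e x * walk e (a + b - 2) x x.
    by rewrite mulr_ge0 ?degree_ge0 ?walk_ge0.
  (* Length 1 is settled by the absence of loops; otherwise [log_convex_prod] would be needed at
     index 0, where it does not apply. *)
  have [a'0|a'0] := posnP a'; first by rewrite [in walk e a x x](_ : a = 1%N) ?w1 ?mul0r //; lia.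
  have [b'0|b'0] := posnP b'; first by rewrite [in walk e b x x](_ : b = 1%N) ?w1 ?mulr0 //; lia.
  rewrite -(@ler_pXn2r _ 2) ?nnegrE // ?mulr_ge0 ?walk_ge0 // exprMn.
  have sq c : walk e (2 * c).+1 x x ^+ 2 <= walk e (2 * c) x x * walk e (2 * c.+1) x x.
    have := @walk_prod_le e c c.+1 x x es; by have -> : (c + c.+1 = (2 * c).+1)%N by lia.
  have -> : (a + b - 2 = 2 * (a' + b'))%N by lia.
  rewrite Ea Eb; apply: (le_trans (ler_pM (sqr_ge0 _) (sqr_ge0 _) (sq a') (sq b'))).
  have h1 : walk e (2 * a') x x * walk e (2 * b'.+1) x x <=
      degree e x * walk e (2 * (a' + b')) x x.
    by have := @log_convex_prod _ _ a' b'.+1 lc a'0 isT; rewrite addnS walk2_degree.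
  have h2 : walk e (2 * a'.+1) x x * walk e (2 * b') x x <=
      degree e x * walk e (2 * (a' + b')) x x.
    by have := @log_convex_prod _ _ a'.+1 b' lc isT b'0; rewrite addSn walk2_degree.
  rewrite [leRHS]expr2.
  rewrite [leLHS](_ : _ = walk e (2 * a') x x * walk e (2 * b'.+1) x x *
    (walk e (2 * a'.+1) x x * walk e (2 * b') x x)); last by ring.
  by apply: (ler_pM _ _ h1 h2); rewrite mulr_ge0 ?walk_ge0.
- have [a' Ea] : exists a', a = (2 * a')%N by exists a./2; lia.
  have [b' Eb] : exists b', b = (2 * b')%N by exists b./2; lia.
  rewrite -walk2_degree // Ea Eb.
  have := @log_convex_prod _ _ a' b' lc; rewrite muln1.
  have -> : (2 * (a' + b').-1 = 2 * a' + 2 * b' - 2)%N by lia.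
  by apply; lia.
Qed.


(** * Pruning to a subgraph with controlled degrees *)

(** A deleted ordered edge has an endpoint z with [degree e z / D] at least 1. Summing this weight
    over the edges at either endpoint gives twice the sum of squared degrees over [D]. *)
Lemma prune_high_degree e (D : R) : symmetric e -> 0 < D ->
  exists e' : rel V, [/\ symmetric e', subrel e' e, forall x, degree e' x <= D &
    open_walks e 1 <= open_walks e' 1 + 2 * (open_walks e 2 / D)].
Proof.
move=> es D0.
pose e' x y := [&& e x y, degree e x <= D & degree e y <= D].
exists e'; split.
- by move=> x y; rewrite /e' es; congr (_ && _); rewrite andbC.
- by move=> x y /and3P[].
- move=> x; case: (boolP (degree e x <= D)) => dx.
    apply: le_trans dx; apply: ler_sum => y _; rewrite ler_nat /e'.
    by case: (e x y); rewrite ?leq_b1.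
  rewrite /degree big1 ?ltW // => y _.
  by rewrite /e' (negPf dx) andbF.
have S : open_walks e 2 / D = \sum_x \sum_y (e x y)%:R * (degree e x / D).
  rewrite open_walks2 // mulr_suml; apply: eq_bigr => x _.
  by rewrite -mulr_suml expr2 mulrA.
have S' : open_walks e 2 / D = \sum_x \sum_y (e x y)%:R * (degree e y / D).
  rewrite S exchange_big; apply: eq_bigr => x _; apply: eq_bigr => y _.
  by rewrite es.
rewrite mulr2n mulrDl mul1r {1}S S' /open_walks -!big_split /=.
apply: ler_sum => x _; rewrite -!big_split /=; apply: ler_sum => y _.
rewrite !sum_diracr /e'; case: (e x y); rewrite ?mul0r ?addr0 //= !mul1r.
have dge z : 0 <= degree e z / D by rewrite divr_ge0 ?degree_ge0 // ltW.
have dgt z : ~~ (degree e z <= D) -> 1 <= degree e z / D.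
  by rewrite -ltNge => /ltW h; rewrite ler_pdivlMr // mul1r.
case: (boolP (degree e x <= D)) (boolP (degree e y <= D)) => dx [] dy /=;
  have := dge x; have := dge y; try have := dgt _ dx; try have := dgt _ dy; lra.
Qed.

(* A set S maximizing e(S) - 2 delta |S| induces a subgraph of minimum degree at
   least delta, since deleting x from S loses at most 2 deg_S(x) ordered edges. *)
Lemma prune_low_degree e (delta : R) : symmetric e -> 0 <= delta ->
  exists e' : rel V, [/\ symmetric e', subrel e' e,
    forall x y, e' x y -> delta <= degree e' x &
    open_walks e 1 <= open_walks e' 1 + 2 * delta * #|V|%:R].
Proof.
move=> es delta0.
pose ind (S : {set V}) x y := [&& e x y, x \in S & y \in S].
have inds S : symmetric (ind S).
  by move=> x y; rewrite /ind es; congr (_ && _); rewrite andbC.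
pose F S : R := open_walks (ind S) 1 - 2 * delta * #|S|%:R.
have [S _ maxS] := @arg_maxP _ _ _ [set: V] predT F isT.
have FT : F [set: V] <= F S by apply: maxS.
have indT : open_walks (ind [set: V]) 1 = open_walks e 1.
  by rewrite !open_walks1; apply: eq_bigr => x _; apply: eq_bigr => y _;
    rewrite /ind !inE !andbT.
have remove x : x \in S ->
    open_walks (ind S) 1 <= open_walks (ind (S :\ x)) 1 + 2 * degree (ind S) x.
  move=> xS; rewrite mulr2n mulrDl mul1r.
  have dl : degree (ind S) x = \sum_y \sum_z (x == y)%:R * (ind S y z)%:R.
    by rewrite -(sum_diracl x (degree (ind S))); apply: eq_bigr => y _; rewrite mulr_sumr.
  have dr : degree (ind S) x = \sum_y \sum_z (x == z)%:R * (ind S y z)%:R.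
    rewrite dl exchange_big; apply: eq_bigr => y _; apply: eq_bigr => z _.
    by rewrite inds.
  rewrite {1}dl dr !open_walks1 -!big_split /=; apply: ler_sum => y _.
  rewrite -!big_split /=; apply: ler_sum => z _.
  rewrite /ind !inE !(eq_sym x) -!natrM -!natrD ler_nat.
  by case: (e y z) (y == x) (z == x) (y \in S) (z \in S) => [] [] [] [] [].
exists (ind S); split=> //.
- by move=> x y /and3P[].
- move=> x y /and3P[_ xS _].
  have := maxS (S :\ x) isT; have := remove x xS.
  by rewrite /F (cardsD1 x S) xS /= natrD; lra.
rewrite -lerBlDr; apply: (@le_trans _ _ (F S)).
  by apply: le_trans FT; rewrite /F indT cardsT.
by rewrite /F lerBlDr lerDl !mulr_ge0.
Qed.

(** A walk with at least one step starts at a non-isolated vertex, so a further step can be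
    prepended in at least [delta] ways. The induction starts at length 1, since isolated vertices
    carry walks of length 0. *)
Lemma open_walks_min_degree e (delta : R) m : symmetric e -> 0 <= delta ->
  (forall x y, e x y -> delta <= degree e x) ->
  delta ^+ m * open_walks e 1 <= open_walks e m.+1.
Proof.
move=> es d0 mind; elim: m => [|m IH]; first by rewrite mul1r.
rewrite exprS -mulrA (le_trans (ler_wpM2l d0 IH)) //.
rewrite -[m.+2]add1n open_walksD // /open_walks mulr_sumr; apply: ler_sum => z _.
have -> : \sum_x walk e 1 z x = degree e z by apply: eq_bigr => x _; rewrite walk1.
case: (boolP [exists y, e z y]) => [/existsP[y /mind dz]|/existsPn nz].
  by rewrite ler_wpM2r // sumr_ge0 // => w _; apply: walk_ge0.
rewrite [X in _ * X <= _]big1 ?mulr0.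
  by rewrite mulr_ge0 ?degree_ge0 ?sumr_ge0 // => w _; apply: walk_ge0.
by move=> y _ /=; rewrite big1 // => w _; rewrite (negPf (nz w)) mul0r.
Qed.

(** * Walks as sums over tuples of vertices *)

Lemma sum_tuple0 (F : seq V -> R) : \sum_(t : 0.-tuple V) F t = F [::].
Proof.
rewrite (bigD1 [tuple]) //= big1 ?addr0 // => t.
by rewrite [t]tuple0 => /eqP.
Qed.

(** Here and below [F] is a function of sequences, so that splitting and rotating tuples needs no
    casts. *)
Lemma sum_tupleS m (F : seq V -> R) :
  \sum_(t : m.+1.-tuple V) F t = \sum_x \sum_(s : m.-tuple V) F (x :: s).
Proof.
rewrite pair_big /=.
rewrite (reindex (fun p : V * m.-tuple V => [tuple of p.1 :: p.2])) //=.
exists (fun t => (thead t, [tuple of behead t])) => [[x s] _|t _] /=.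
  by congr pair; apply: val_inj.
by rewrite -tuple_eta.
Qed.

Lemma sum_tuple_cat m n (F : seq V -> R) :
  \sum_(t : (m + n).-tuple V) F t =
  \sum_(s : m.-tuple V) \sum_(u : n.-tuple V) F (s ++ u).
Proof.
elim: m F => [|m IH] F.
  by rewrite (sum_tuple0 (fun s => \sum_(u : n.-tuple V) F (s ++ u))).
rewrite addSn sum_tupleS (sum_tupleS m (fun s => \sum_(u : n.-tuple V) F (s ++ u))).
apply: eq_bigr => x _.
exact: (IH (fun s => F (x :: s))).
Qed.

Lemma sum_tuple_rot m i (F : seq V -> R) :
  \sum_(t : m.-tuple V) F (rot i t) = \sum_(t : m.-tuple V) F t.
Proof.
rewrite [RHS](reindex (fun t : m.-tuple V => [tuple of rot i t])) //=.
by exists (fun t : m.-tuple V => [tuple of rotr i t]) => t _;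
  apply: val_inj; rewrite /= ?rotK ?rotrK.
Qed.

Lemma walkE e m x y :
  walk e m x y = \sum_(s : m.-tuple V) (path e x s && (last x s == y))%:R.
Proof.
elim: m x => [|m IH] x; first by rewrite (sum_tuple0 (fun s => (path e x s && (last x s == y))%:R)).
rewrite (sum_tupleS m (fun s => (path e x s && (last x s == y))%:R)).
rewrite [LHS]/=; apply: eq_bigr => z _; rewrite IH mulr_sumr; apply: eq_bigr => s _ /=.
by rewrite -natrM mulnb andbA.
Qed.

Lemma open_walksE e m :
  open_walks e m = \sum_(t : m.+1.-tuple V) (sorted e t)%:R.
Proof.
rewrite (sum_tupleS m (fun t => (sorted e t)%:R)); apply: eq_bigr => x _.
under eq_bigr do rewrite walkE.
rewrite exchange_big; apply: eq_bigr => s _ /=.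
rewrite -[RHS]mulr1 -[X in _ * X](sum_diracl (last x s) (fun=> 1)) mulr_sumr.
by apply: eq_bigr => y _; rewrite mulr1 -natrM mulnb.
Qed.

Lemma walk_cycleE e m v :
  walk e m.+1 v v = \sum_(s : m.-tuple V) (cycle e (v :: s))%:R.
Proof.
rewrite -addn1 walkD; under eq_bigr do rewrite walk1 walkE mulr_suml.
rewrite exchange_big; apply: eq_bigr => s _ /=.
rewrite rcons_path -mulnb natrM -(sum_diracl (last v s) (fun z => (e z v)%:R)) mulr_sumr.
by apply: eq_bigr => z _; rewrite -mulnb natrM mulrA.
Qed.

Lemma closed_walksS e m :
  closed_walks e m.+1 = \sum_(t : m.+1.-tuple V) (cycle e t)%:R.
Proof.
rewrite (sum_tupleS m (fun t => (cycle e t)%:R)).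
by apply: eq_bigr => v _; rewrite walk_cycleE.
Qed.

(** * Closed walks that repeat a vertex *)

(** A closed walk that returns to its start after [a] steps is cut there into two closed walks at
    the same vertex. *)
Lemma cycle_coincidence e a b x0 : (0 < a)%N -> (0 < b)%N ->
  \sum_(t : (a + b).-tuple V) (cycle e t && (nth x0 t 0 == nth x0 t a))%:R =
  \sum_v walk e a v v * walk e b v v.
Proof.
case: a b => [//|a] [//|b] _ _; rewrite addSn.
rewrite (sum_tupleS _ (fun t => (cycle e t && (nth x0 t 0 == nth x0 t a.+1))%:R)).
apply: eq_bigr => v _.
rewrite (sum_tuple_cat a b.+1
  (fun t => (cycle e (v :: t) && (nth x0 (v :: t) 0 == nth x0 (v :: t) a.+1))%:R)).
rewrite !walk_cycleE mulr_suml; apply: eq_bigr => s _.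
rewrite (sum_tupleS b
  (fun u => (cycle e (v :: s ++ u) && (nth x0 (v :: s ++ u) 0 == nth x0 (v :: s ++ u) a.+1))%:R)).
rewrite mulr_sumr -[RHS](sum_diracl v (fun=> \sum_(u : b.-tuple V) _)).
apply: eq_bigr => w _; rewrite mulr_sumr; apply: eq_bigr => u _.
rewrite -!natrM !mulnb andbC [X in X && _](_ : _ = (v == w)); last first.
  by rewrite /= nth_cat size_tuple ltnn subnn.
congr (nat_of_bool _)%:R; case: eqP => // <- /=.
by rewrite rcons_cat cat_path /= !rcons_path andbA.
Qed.

(** A union bound over the pairs of positions that may coincide; each pair contributes at most
    [D * closed_walks e (m - 2)] by [walk_split_le]. *)
Lemma nonuniq_cycles_le e m (D : R) (x0 : V) : symmetric e -> irreflexive e ->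
  ~~ odd m -> (forall x, degree e x <= D) ->
  \sum_(t : m.-tuple V) (cycle e t && ~~ uniq t)%:R <=
  m%:R ^+ 2 * (D * closed_walks e (m - 2)).
Proof.
move=> es ei om degD.
pose hit (i k : nat) (t : seq V) : R := (cycle e t && (nth x0 t i == nth x0 t k))%:R.
have D0 : 0 <= D by apply: le_trans (degree_ge0 e x0) (degD x0).
have B0 : 0 <= D * closed_walks e (m - 2) by rewrite mulr_ge0 ?closed_walks_ge0.
have hit_le (i k : nat) : (i < k < m)%N ->
    \sum_(t : m.-tuple V) hit i k t <= D * closed_walks e (m - 2).
  move=> /andP[ik km].
  have -> : \sum_(t : m.-tuple V) hit i k t = \sum_(t : m.-tuple V) hit 0%N (k - i)%N t.
    (* Rotating by i turns a coincidence at positions i and k into one at positions 0 and k - i. *)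
    rewrite -(@sum_tuple_rot m i (hit 0%N (k - i)%N)); apply: eq_bigr => t _.
    rewrite /hit rot_cycle /rot !nth_cat !size_drop size_tuple !nth_drop.
    by rewrite subn_gt0 (ltn_trans ik km) ltn_sub2r ?(ltn_trans ik km) // addn0 subnKC // ltnW.
  have mE : m = (k - i + (m - (k - i)))%N by lia.
  rewrite /hit [in \sum_t _]mE cycle_coincidence ?subn_gt0 //; last by lia.
  rewrite mulr_sumr; apply: ler_sum => v _.
  apply: (le_trans (walk_split_le v es ei _ _ _)); rewrite -?mE ?subn_gt0 //; first by lia.
  by rewrite ler_wpM2r ?walk_ge0.
apply: (@le_trans _ _ (\sum_(t : m.-tuple V) \sum_(i < m) \sum_(k < m | (i < k)%N) hit i k t)).
  apply: ler_sum => t _.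
  case: (boolP (cycle e t)) => ct /=; last first.
    by do 3?[apply: sumr_ge0 => ? _]; rewrite /hit ler0n.
  case: (boolP (uniq t)) => [_|/(uniqPn x0)[i [k [ik]]]] /=.
    by do 3?[apply: sumr_ge0 => ? _]; rewrite /hit ler0n.
  rewrite size_tuple => km eqt.
  (* The single term for the coincidence found already equals 1. *)
  rewrite (bigD1 (Ordinal (ltn_trans ik km))) //= (bigD1 (Ordinal km)) //=.
  rewrite /hit ct eqt eqxx /= -addrA lerDl addr_ge0 //.
    by apply: sumr_ge0.
  by apply: sumr_ge0 => ? _; apply: sumr_ge0.
rewrite exchange_big /= expr2 -mulrA mulr_natl -[X in _ *+ X]card_ord -sumr_const.
apply: ler_sum => i _; rewrite exchange_big mulr_natl -[X in _ *+ X]card_ord -sumr_const.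
apply: (@le_trans _ _ (\sum_(k < m | (i < k)%N) D * closed_walks e (m - 2))).
  by apply: ler_sum => k ik; apply: hit_le; rewrite ik ltn_ord.
by rewrite [leRHS](bigID (fun k : 'I_m => (i < k)%N)) /= lerDl sumr_ge0.
Qed.

(** * Lower bounds for injective paths and cycles *)

(** The first vertex has at least [delta] neighbours, of which at most m + 1 lie on the path; any
    other can be prepended. The condition 0 < m gives the first vertex an edge, so that the degree
    bound applies to it. *)
Lemma uniq_paths_extend e (delta : R) m : symmetric e -> m.+1%:R <= delta ->
  (forall x y, e x y -> delta <= degree e x) -> (0 < m)%N ->
  (delta - m.+1%:R) * \sum_(t : m.+1.-tuple V) (sorted e t && uniq t)%:R <=
  \sum_(t : m.+2.-tuple V) (sorted e t && uniq t)%:R.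
Proof.
move=> es md mind m0.
rewrite (sum_tupleS m.+1 (fun t => (sorted e t && uniq t)%:R)) exchange_big mulr_sumr.
apply: ler_sum => t _.
case: (boolP (sorted e t && uniq t)) => [/andP[st ut]|_]; last first.
  by rewrite mulr0 sumr_ge0.
rewrite mulr1.
have [x [s ts]] : exists x s, t = x :: s :> seq V.
  by exists (thead t), (behead t); rewrite -[LHS]/(val t) {1}(tuple_eta t).
have sz : size t = m.+1 by rewrite size_tuple.
have dx : delta <= degree e x.
  move: st sz m0; rewrite ts; case: s {ts} => [|y s] /=; first by move=> _ [<-].
  by move=> /andP[/mind].
have : degree e x <= \sum_y (sorted e (y :: t) && uniq (y :: t))%:R + m.+1%:R.
  have <- : \sum_y (y \in (t : seq V))%:R = m.+1%:R :> R.
    transitivity (#|t|%:R : R); last by rewrite (card_uniqP ut) sz.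
    rewrite -sum1_card natr_sum [RHS]big_mkcond /=.
    by apply: eq_bigr => y _; case: (y \in _).
  rewrite -big_split /=; apply: ler_sum => y _.
  rewrite -natrD ler_nat ut ts /= es -[path e x s]/(sorted e (x :: s)) -ts st.
  by case: (e y x) (y \in _) => [] [].
by rewrite lerBlDr; apply: le_trans.
Qed.

Lemma uniq_paths_ge e (delta : R) m : symmetric e -> irreflexive e ->
  (2 * m.+1)%:R <= delta -> (forall x y, e x y -> delta <= degree e x) ->
  (delta / 2) ^+ m * open_walks e 1 <=
  \sum_(t : m.+2.-tuple V) (sorted e t && uniq t)%:R.
Proof.
move=> es ei; elim: m => [|m IH] md mind.
  rewrite mul1r open_walksE; apply: ler_sum => t _; rewrite ler_nat.
  case: t => [[|x [|y [|z s]]] //= _]; rewrite inE !andbT.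
  by case: (eqVneq x y) => [->|_]; rewrite ?ei ?andbT.
have dS : (2 * m.+1)%:R <= delta by apply: le_trans md; rewrite ler_nat; lia.
have d0 : 0 <= delta by apply: le_trans dS.
have mle : m.+2%:R <= delta by apply: le_trans md; rewrite ler_nat; lia.
apply: le_trans (uniq_paths_extend es mle mind isT).
rewrite exprS -mulrA; apply: ler_pM => //.
- by rewrite divr_ge0.
- by rewrite mulr_ge0 ?open_walks_ge0 ?exprn_ge0 ?divr_ge0.
(* At most half of the neighbours are excluded, hence the factor [delta / 2] per step. *)
- by move: md; rewrite natrM; lra.
exact: IH.
Qed.

Definition uniq_paths e j : R :=
  \sum_(t : j.+1.-tuple V) (sorted e t && uniq t)%:R.
Definition uniq_cycles e m : R :=
  \sum_(t : m.-tuple V) (cycle e t && uniq t)%:R.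

Lemma uniq_paths_le_open e j : uniq_paths e j <= open_walks e j.
Proof.
by rewrite open_walksE; apply: ler_sum => t _; rewrite ler_nat;
  case: (sorted e t) (uniq t) => [] [].
Qed.

Lemma uniq_paths_subrel e e' j : subrel e' e -> uniq_paths e' j <= uniq_paths e j.
Proof.
move=> sub; apply: ler_sum => t _; rewrite ler_nat.
by case: (boolP (sorted e' t)) => // /(sub_sorted sub) ->.
Qed.

Lemma uniq_cycles_subrel e e' m : subrel e' e -> uniq_cycles e' m <= uniq_cycles e m.
Proof.
move=> sub; apply: ler_sum => t _; rewrite ler_nat.
by case: (boolP (cycle e' t)) => // /(sub_cycle sub) ->.
Qed.

Lemma closed_walks_cycles e m : (0 < m)%N ->
  closed_walks e m = uniq_cycles e m + \sum_(t : m.-tuple V) (cycle e t && ~~ uniq t)%:R.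
Proof.
case: m => [//|m] _; rewrite closed_walksS -big_split; apply: eq_bigr => t _ /=.
by rewrite -natrD; case: (cycle e t) (uniq t) => [] [].
Qed.

Lemma uniq_cycles_le_closed e m : (0 < m)%N -> uniq_cycles e m <= closed_walks e m.
Proof. by move=> m0; rewrite closed_walks_cycles // lerDl sumr_ge0. Qed.

(** The thresholds are balanced so that each pruning loses at most a quarter of [eps * x * #|V|]
    ordered edges, which leaves half of that amount. *)
Lemma exists_subrel_bounded_degree e (eps C x : R) : symmetric e -> 0 < eps -> 0 < C -> 0 < x ->
  open_walks e 2 <= #|V|%:R * (C * x ^+ 2) -> eps * x * #|V|%:R <= open_walks e 1 ->
  exists e' : rel V, [/\ symmetric e', subrel e' e,
    forall v, degree e' v <= 8 * C / eps * x,
    forall v w, e' v w -> eps / 8 * x <= degree e' v &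
    eps / 2 * x * #|V|%:R <= open_walks e' 1].
Proof.
move=> es eps0 C0 x0 o2 o1.
have D0 : 0 < 8 * C / eps * x by rewrite !mulr_gt0 ?invr_gt0 // ltr0n.
have [e1 [s1 sub1 deg1 edges1]] := prune_high_degree es D0.
have d0 : 0 <= eps / 8 * x by rewrite ltW // !mulr_gt0 // invr_gt0 ltr0n.
have [e2 [s2 sub2 deg2 edges2]] := prune_low_degree s1 d0.
exists e2; split=> //.
- by move=> v w /sub2 /sub1.
- move=> v; apply: le_trans (deg1 v); apply: ler_sum => w _; rewrite ler_nat.
  by case: (boolP (e2 v w)) => // /sub2 ->.
have : open_walks e 2 / (8 * C / eps * x) <= eps / 8 * x * #|V|%:R.
  rewrite ler_pdivrMr //; apply: (le_trans o2); rewrite le_eqVlt; apply/orP; left; apply/eqP.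
  by field; rewrite gt_eqF.
lra.
Qed.

(** The minimum degree gives many walks of length k, hence by [open_walks_closed] many closed walks
    of length 2k. Those with a repeated vertex have one factor of [x] less, and the last hypothesis
    makes them at most half of the lower bound. *)
Lemma uniq_cycles_ge e (eps C x : R) k : symmetric e -> irreflexive e ->
  0 < eps -> 0 < C -> 0 < x -> (0 < #|V|)%N -> (1 < k)%N ->
  (forall v, degree e v <= 8 * C / eps * x) ->
  (forall v w, e v w -> eps / 8 * x <= degree e v) ->
  eps / 2 * x * #|V|%:R <= open_walks e 1 ->
  closed_walks e (2 * k.-1) <= (C * x ^+ 2) ^+ k.-1 ->
  64 * k%:R ^+ 2 * C ^+ k / eps <= (eps / 8) ^+ (2 * k) * x ->
  (eps / 8) ^+ (2 * k) / 2 * x ^+ (2 * k) <= uniq_cycles e (2 * k).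
Proof.
case: k => [//|k] es ei eps0 C0 x0 V0 _ degD mind o1 tk big.
have n0 : 0 < #|V|%:R :> R by rewrite ltr0n.
have d0 : 0 <= eps / 8 * x by rewrite ltW // !mulr_gt0 // invr_gt0 ltr0n.
have walks_ge : (eps / 8 * x) ^+ k.+1 * #|V|%:R <= open_walks e k.+1.
  apply: le_trans (open_walks_min_degree k es d0 mind).
  rewrite exprSr -mulrA ler_wpM2l ?exprn_ge0 //; apply: le_trans o1.
  by rewrite ler_pM2r // ler_pM2r //; lra.
have closed_ge : (eps / 8 * x) ^+ (2 * k.+1) <= closed_walks e (2 * k.+1).
  have n2 : 0 < #|V|%:R ^+ 2 :> R by rewrite exprn_gt0.
  rewrite -(ler_pM2l n2); apply: le_trans (open_walks_closed _ es).
  rewrite mulrC (mulnC 2) exprM -exprMn ler_pXn2r ?nnegrE ?open_walks_ge0 //.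
  by rewrite mulr_ge0 ?exprn_ge0.
have /card_gt0P[v0 _] := V0.
have even2k : ~~ odd (2 * k.+1) by rewrite mul2n odd_double.
have := nonuniq_cycles_le v0 es ei even2k degD.
have -> : (2 * k.+1 - 2 = 2 * k)%N by rewrite mulnS addKn.
have D0 : 0 <= 8 * C / eps * x by rewrite ltW // !mulr_gt0 ?invr_gt0 // ltr0n.
move=> /le_trans /(_ (ler_wpM2l (sqr_ge0 _) (ler_wpM2l D0 tk))) nonuniq.
have cE := @closed_walks_cycles e (2 * k.+1) isT.
(* The constants multiply to 4 * 8 = 32, half of the 64 in the hypothesis on [x]. *)
have : (2 * k.+1)%:R ^+ 2 * (8 * C / eps * x * (C * x ^+ 2) ^+ k) <=
    (eps / 8) ^+ (2 * k.+1) / 2 * x ^+ (2 * k.+1).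
  have -> : (2 * k.+1)%:R ^+ 2 * (8 * C / eps * x * (C * x ^+ 2) ^+ k) =
      64 * k.+1%:R ^+ 2 * C ^+ k.+1 / eps * (x ^+ (2 * k).+1 / 2).
    rewrite natrM !exprMn -exprD addnn -mul2n [C ^+ k.+1]exprS [x ^+ (2 * k).+1]exprS.
    by field; rewrite gt_eqF.
  have xx : x ^+ (2 * k.+1) = x * x ^+ (2 * k).+1 by rewrite -exprS mulnS.
  rewrite xx [leRHS](_ : _ = (eps / 8) ^+ (2 * k.+1) * x * (x ^+ (2 * k).+1 / 2)); last by ring.
  by rewrite ler_wpM2r // divr_ge0 ?exprn_ge0 // ltW.
rewrite exprMn in closed_ge; lra.
Qed.

End Walks.

(** * From homomorphisms to sums over tuples *)

Section Counting.
Variables (R : realFieldType).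

Lemma card_ffun_tuple (T : finType) m (P : pred {ffun 'I_m -> T}) (Q : pred (seq T)) :
  (forall t : m.-tuple T, P [ffun i => tnth t i] = Q t) ->
  #|[set f | P f]|%:R = \sum_(t : m.-tuple T) (Q t)%:R :> R.
Proof.
move=> PQ; rewrite -sum1_card natr_sum big_mkcond /=.
rewrite (reindex (fun t : m.-tuple T => [ffun i => tnth t i])) /=.
  by apply: eq_bigr => t _; rewrite inE PQ; case: (Q t).
exists (fun f : {ffun 'I_m -> T} => [tuple f i | i < m]) => [t|f] _.
  by apply: eq_from_tnth => i; rewrite tnth_mktuple ffunE.
by apply/ffunP => i; rewrite ffunE tnth_mktuple.
Qed.

Lemma injectiveb_tnth (T : finType) m (t : m.-tuple T) :
  injectiveb [ffun i => tnth t i] = uniq t.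
Proof.
apply/injectiveP/tuple_uniqP => inj i k; last by rewrite !ffunE => /inj.
by move=> E; apply: inj; rewrite !ffunE.
Qed.

Lemma is_hom_path (G : sgraph) j (t : j.+1.-tuple G) :
  @is_hom (path_graph j) G [ffun i => tnth t i] = sorted (@adj G) t.
Proof.
have x0 := thead t.
apply/forallP/(sortedP x0) => [H i|H a].
  rewrite size_tuple => ij.
  have := H (Ordinal (ltnW ij)) => /forallP /(_ (Ordinal ij)) /implyP.
  by rewrite !ffunE !(tnth_nth x0) /= /path_adj /= eqxx; apply.
apply/forallP => b; apply/implyP; rewrite !ffunE !(tnth_nth x0) /= /path_adj.
case/orP => /eqP E; last rewrite adj_sym; rewrite E; apply: H;
  by rewrite size_tuple -E ltn_ord.
Qed.

Lemma cycle_ordS (T : Type) (e : rel T) m (t : m.-tuple T) :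
  cycle e t <-> forall i : 'I_m, e (tnth t i) (tnth t (ordS i)).
Proof.
case: m t => [|m] t; first by rewrite tuple0; split=> // _ [].
have [x [s ts]] : exists x (s : m.-tuple T), t = [tuple of x :: s].
  by exists (thead t), [tuple of behead t]; apply: tuple_eta.
(* Appending the head x at the end implements the wrap-around of [ordS]. *)
have nthS (i : 'I_m.+1) : nth x (rcons s x) i = tnth t (ordS i).
  rewrite ts (tnth_nth x) /= nth_rcons size_tuple.
  have := ltn_ord i; rewrite ltnS leq_eqVlt => /orP[/eqP ->|im].
    by rewrite ltnn eqxx modnn.
  by rewrite im modn_small.
have nth0 (i : 'I_m.+1) : nth x (x :: rcons s x) i = tnth t i.
  by rewrite ts (tnth_nth x) -rcons_cons nth_rcons /= size_tuple ltn_ord.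
have -> : cycle e t = path e x (rcons s x) by rewrite ts.
split=> [/(pathP x) H i|H].
  by rewrite -nthS -nth0; apply: H; rewrite size_rcons size_tuple.
apply/(pathP x) => i; rewrite size_rcons size_tuple => im.
by rewrite (nthS (Ordinal im)) (nth0 (Ordinal im)).
Qed.

(** For m = 1 the two sides differ: [cycle_graph 1] has no edge, while [cycle] asks for a loop. For
    m > 1, [ordS i] differs from i, so every consecutive pair is an edge. *)
Lemma is_hom_cycle (G : sgraph) m (t : m.-tuple G) : (1 < m)%N ->
  @is_hom (cycle_graph m) G [ffun i => tnth t i] = cycle (@adj G) t.
Proof.
move=> m1; apply/idP/idP => [/forallP H|/cycle_ordS H].
  apply/cycle_ordS => i.
  have := H i => /forallP /(_ (ordS i)) /implyP; rewrite !ffunE; apply.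
  rewrite /= /cycle_adj eqxx /= andbT; apply/eqP => /(congr1 val) /=.
  have := ltn_ord i; rewrite leq_eqVlt => /orP[/eqP E|im].
    by rewrite E modnn => i0; move: E m1; rewrite i0 => <-.
  by rewrite modn_small // => /n_Sn.
apply/forallP => a; apply/forallP => b; apply/implyP; rewrite !ffunE /= => /andP[_].
by case/orP => /eqP ->; rewrite // adj_sym.
Qed.

Lemma nb_hom_path (G : sgraph) j :
  (nb_hom (path_graph j) G)%:R = open_walks R (@adj G) j.
Proof. by rewrite open_walksE; apply: card_ffun_tuple => t; apply: is_hom_path. Qed.

Lemma nb_hom_cycle (G : sgraph) m : (1 < m)%N ->
  (nb_hom (cycle_graph m) G)%:R = closed_walks R (@adj G) m.
Proof.
case: m => [//|m] m1; rewrite closed_walksS.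
by apply: card_ffun_tuple => t; apply: is_hom_cycle.
Qed.

Lemma nb_inj_path (G : sgraph) j :
  (nb_inj (path_graph j) G)%:R = uniq_paths R (@adj G) j.
Proof.
apply: (card_ffun_tuple (Q := fun t => sorted (@adj G) t && uniq t)) => t.
by rewrite is_hom_path injectiveb_tnth.
Qed.

Lemma nb_inj_cycle (G : sgraph) m : (1 < m)%N ->
  (nb_inj (cycle_graph m) G)%:R = uniq_cycles R (@adj G) m.
Proof.
move=> m1; apply: (card_ffun_tuple (Q := fun t => cycle (@adj G) t && uniq t)) => t.
by rewrite is_hom_cycle // injectiveb_tnth.
Qed.

End Counting.

(** * Choice of constants and assembly *)

Theorem theorem5p1 (R : realType) (eps C : R) (j k l : nat)
    (eps_gt0 : 0 < eps) (C_gt0 : 0 < C)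
    (j_ge1 : (1 <= j)%N) (l_ge2 : (2 <= l)%N) (l_lt_k : (l < k)%N) :
  exists (n0 : nat) (alpha beta : R),
    [/\ (0 < n0)%N, 0 < alpha, alpha <= beta &
      forall (n : nat) (p : R) (G : sgraph),
        (n0 <= n)%N -> 0 < p -> #|G| = n ->
        eps * p * n%:R ^+ 2 <= (nb_hom (path_graph 1) G)%:R ->
        (nb_hom (cycle_graph (2 * l)) G)%:R
          <= C * p ^+ (2 * l) * n%:R ^+ (2 * l) ->
        (alpha * p ^+ j * n%:R ^+ j.+1 <= (nb_inj (path_graph j) G)%:R
           <= beta * p ^+ j * n%:R ^+ j.+1) /\
        (alpha * p ^+ (2 * k) * n%:R ^+ (2 * k)
           <= (nb_inj (cycle_graph (2 * k)) G)%:R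
           <= beta * p ^+ (2 * k) * n%:R ^+ (2 * k))].
Proof.
have l_gt0 : (0 < l)%N by lia.
have l2_gt1 : (1 < 2 * l)%N by lia.
have k_gt1 : (1 < k)%N by lia.
have k2_gt1 : (1 < 2 * k)%N by lia.
have l_le_k1 : (l <= k.-1)%N by lia.
(* A constant at least 1, so that [C <= C1 ^+ l] and [C1 <= C1 ^+ 2]. *)
pose C1 := 1 + C.
have C1_ge1 : 1 <= C1 by rewrite lerDl ltW.
have C1_gt0 : 0 < C1 by apply: lt_le_trans C1_ge1.
pose a1 := (eps / 16) ^+ j; pose a2 := (eps / 8) ^+ (2 * k).
have a1_gt0 : 0 < a1 by rewrite exprn_gt0 // divr_gt0.
have a2_gt0 : 0 < a2 by rewrite exprn_gt0 // divr_gt0.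
pose alpha := Num.min a1 (a2 / 2).
(* The first bound makes the pruned degrees at least 2j, as greedy extension requires; the second is
   the largeness condition of [uniq_cycles_ge]. *)
pose x0 := Num.max (16 * j%:R / eps) (64 * k%:R ^+ 2 * C1 ^+ k / eps / a2).
have x0_ge0 : 0 <= x0 by rewrite le_max; apply/orP; left; rewrite divr_ge0 ?mulr_ge0 ?ler0n // ltW.
have alpha_gt0 : 0 < alpha by rewrite lt_min a1_gt0 divr_gt0.
have y_ge0 : 0 <= (C1 / eps * x0) ^+ l.
  by rewrite exprn_ge0 // mulr_ge0 // ltW // divr_gt0.
(* It will turn out that n is at most the l-th power of [C1 / eps * x], so this threshold on n
   forces [x0 < x]. The summands of beta serve, in turn, alpha <= beta, the paths and the cycles. *)
exists (Num.bound ((C1 / eps * x0) ^+ l)).+1, alpha, (alpha + C1 ^+ j + C1 ^+ k).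
have C1X m : 0 <= C1 ^+ m by rewrite exprn_ge0 // ltW.
split=> //; first by rewrite -addrA lerDl addr_ge0.
move=> n p G n_large p_gt0 cardG.
have n_gt0 : (0 < n)%N by apply: leq_trans n_large.
have nR_gt0 : 0 < n%:R :> R by rewrite ltr0n.
rewrite nb_hom_path nb_hom_cycle //.
rewrite nb_inj_path nb_inj_cycle //.
set e := @adj G; have es : symmetric e := @adj_sym G.
have ei : irreflexive e := @adj_irrefl G.
set x := p * n%:R; have x_gt0 : 0 < x by rewrite mulr_gt0.
have scale_path c : c * p ^+ j * n%:R ^+ j.+1 = c * x ^+ j * n%:R.
  by rewrite /x exprMn exprSr !mulrA.
have scale_cycle c m : c * p ^+ m * n%:R ^+ m = c * x ^+ m.
  by rewrite /x exprMn mulrA.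
rewrite !scale_path !scale_cycle => edges.
have {edges} edges : eps * x * #|G|%:R <= open_walks R e 1.
  by rewrite cardG /x mulrA -[_ * n%:R * _]mulrA -expr2.
clearbody x; have Q_gt0 : 0 < C1 * x ^+ 2 by rewrite mulr_gt0 ?exprn_gt0.
have V_gt0 : (0 < #|G|)%N by rewrite cardG.
move=> cycles.
have {cycles} cycles : closed_walks R e (2 * l) <= (C1 * x ^+ 2) ^+ l.
  apply: (le_trans cycles); rewrite exprMn -exprM ler_wpM2r ?exprn_ge0 ?ltW //.
  apply: (@lt_le_trans _ _ C1); first by rewrite /C1; lra.
  by apply: ler_eXnr.
have x_large : x0 < x.
  (* The closed walk counts start with t_0 = n and t_1 at least [eps * x * n], so t_l is at least n
     times the l-th power of [eps * x]. *)
  have spread := log_convex_expr_le (d := eps * x) l (closed_walks_log_convex R es).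
  rewrite /= muln0 muln1 closed_walks0 closed_walks2 // -open_walks1 in spread.
  have {}spread : (eps * x) ^+ l * n%:R <= (C1 * x ^+ 2) ^+ l.
    by apply: le_trans cycles; rewrite -cardG spread ?mulr_gt0 // ltr0n.
  rewrite ltNge; apply/negP => x_small.
  have : n%:R <= (C1 / eps * x0) ^+ l.
    apply: (@le_trans _ _ ((C1 / eps * x) ^+ l)); last first.
      by rewrite ler_pXn2r ?nnegrE ?ler_pM2l ?mulr_ge0 ?divr_gt0 ?invr_ge0 // ltW.
    rewrite -(@ler_pM2l _ ((eps * x) ^+ l)) ?exprn_gt0 ?mulr_gt0 //.
    apply: (le_trans spread); rewrite -exprMn le_eqVlt; apply/orP; left; apply/eqP.
    by congr (_ ^+ _); field; rewrite gt_eqF.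
  rewrite leNgt => /negP; apply; apply: (lt_le_trans (archi_boundP y_ge0)).
  by rewrite ler_nat ltnW.
have [e' [es' sub deg' mind' edges']] :
    exists e' : rel G, [/\ symmetric e', subrel e' e,
      forall v, degree R e' v <= 8 * C1 / eps * x,
      forall v w, e' v w -> eps / 8 * x <= degree R e' v &
      eps / 2 * x * #|G|%:R <= open_walks R e' 1].
  apply: exists_subrel_bounded_degree => //.
  by have := @open_walks_even_le _ _ e (C1 * x ^+ 2) l 1 es Q_gt0 l_gt0 V_gt0 cycles.
have ei' : irreflexive e' by move=> v; apply/negP => /sub; rewrite /= ei.
have closed_le s : (l <= s)%N -> closed_walks R e (2 * s) <= (C1 * x ^+ 2) ^+ s.
  exact: closed_walks_le_expr.
split; apply/andP; split.
- apply: le_trans (uniq_paths_subrel R j sub).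
  (* [uniq_paths_ge] counts paths with at least one edge, so j is written as a successor. *)
  case: j j_ge1 @a1 a1_gt0 @alpha @x0 x_large {x0_ge0 y_ge0 n_large alpha_gt0 scale_path}
    => [//|i] _ a1 _ alpha x0 x_large.
  have d_large : (2 * i.+1)%:R <= eps / 8 * x.
    have : 16 * i.+1%:R / eps <= x.
      by apply: le_trans (ltW x_large); rewrite le_max lexx.
    by rewrite ler_pdivrMr // natrM; lra.
  apply: le_trans (uniq_paths_ge es' ei' d_large mind').
  rewrite cardG in edges'.
  apply: (@le_trans _ _ (a1 * x ^+ i.+1 * n%:R)).
    by rewrite ler_pM2r // ler_pM2r ?exprn_gt0 // ge_min lexx.
  have d_gt0 : 0 < eps / 8 * x by rewrite mulr_gt0 // divr_gt0.
  have h_gt0 : 0 < eps / 16 * x by rewrite mulr_gt0 // divr_gt0.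
  rewrite /a1 -exprMn exprSr -[leLHS]mulrA; apply: ler_pM.
  - by rewrite exprn_ge0 // ltW.
  - by rewrite mulr_ge0 // ltW.
  - rewrite (_ : eps / 8 * x / 2 = eps / 16 * x) //; lra.
  apply: le_trans edges'; rewrite ler_pM2r // ler_pM2r //; lra.
- apply: (le_trans (uniq_paths_le_open R e j)).
  apply: (@le_trans _ _ (C1 ^+ j * x ^+ j * n%:R)); last first.
    rewrite ler_pM2r // ler_pM2r ?exprn_gt0 //.
    by have := C1X k; lra.
  have bound_ge0 : 0 <= C1 ^+ j * x ^+ j * n%:R.
    by rewrite !mulr_ge0 // exprn_ge0 // ltW.
  (* Squares are compared because [open_walks_le] bounds the square of the count. *)
  rewrite -(@ler_pXn2r _ 2) ?nnegrE ?open_walks_ge0 //.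
  apply: (le_trans (open_walks_le j es Q_gt0 l_gt0 V_gt0 cycles)).
  rewrite cardG mulrC [leRHS]exprMn ler_wpM2r ?exprn_ge0 // -exprMn exprAC.
  have Q_le : C1 * x ^+ 2 <= (C1 * x) ^+ 2.
    by rewrite [leRHS]exprMn ler_wpM2r ?exprn_ge0 ?(ltW x_gt0) // expr2 ler_peMl // ltW.
  by rewrite lerXn2r // nnegrE ?(ltW Q_gt0) // exprn_ge0 // mulr_ge0 // ltW.
- apply: le_trans (uniq_cycles_subrel R (2 * k) sub).
  apply: (@le_trans _ _ (a2 / 2 * x ^+ (2 * k))).
    by rewrite ler_pM2r ?exprn_gt0 // ge_min lexx orbT.
  apply: (uniq_cycles_ge es' ei' eps_gt0 C1_gt0 x_gt0) => //.
    (* The strict inequality l < k is spent here: the closed walk bound is needed at k - 1. *)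
    exact: le_trans (closed_walks_subrel R _ sub) (closed_le _ l_le_k1).
  rewrite -/a2 [leRHS]mulrC -ler_pdivrMr //; apply: le_trans (ltW x_large).
  by rewrite le_max lexx orbT.
apply: (le_trans (uniq_cycles_le_closed R e (ltnW k2_gt1))).
apply: (le_trans (closed_le _ (ltnW l_lt_k))).
rewrite exprMn -exprM ler_pM2r ?exprn_gt0 //.
by have := C1X j; lra.
Qed.
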